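(* Let $p$ be a prime, $S$ a finite $p$-group and $\mathcal{F}$ a saturated fusion system over $S$. Let $P,P'\leq S$ be subgroups and let each of $q,q'$ be $0$ or a prime number, with the convention that $P=S$ if $q=p$, and $P'=S$ if $q'=p$. Then $\mathcal{I}_{P,q} \subseteq \mathcal{I}_{P',q'}$ if and only if one of the following holds: (a) $q=q'$ and $P \sim_{\mathcal{F}} P'$; or (b) $q=0$, $q'\notin \{0,p\}$ and $P \sim_{\mathcal{F}} P'$; or (c) $q=0$ and $q'=p$. In particular, $\mathcal{I}_{P,q}$ is a minimal prime ideal of $A(\mathcal{F})$ if and only if $q=0$, and it is a maximal ideal of $A(\mathcal{F})$ if and only if $q\neq 0$.
   Context: Fusion systems. Let $p$ be a prime and $S$ a finite $p$-group. A fusion system $\mathcal{F}$ over $S$ is a category whose objects are the subgroups of $S$ and whose morphism sets $\mathcal{F}(P,Q)$ satisfy: (i) every morphism in $\mathcal{F}(P,Q)$ is an injective group homomorphism $P\to Q$; (ii) for every $s\in S$ with $sPs^{-1}\leq Q$, the map $P\to Q$, $x\mapsto sxs^{-1}$ belongs to $\mathcal{F}(P,Q)$; (iii) if $\varphi\in\mathcal{F}(P,Q)$ then $\varphi:P\to\varphi(P)$ and $\varphi^{-1}:\varphi(P)\to P$ are morphisms of $\mathcal{F}$. Subgroups $P,Q$ are $\mathcal{F}$-isomorphic ($P\sim_{\mathcal{F}}Q$) if they are isomorphic in $\mathcal{F}$. $\mathcal{F}$ is saturated if each $\mathcal{F}$-isomorphism class of subgroups contains a subgroup $P$ such that: $\mathrm{Aut}_S(P)$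 (automorphisms of $P$ induced by conjugation by elements of $N_S(P)$) is a Sylow $p$-subgroup of $\mathrm{Aut}_{\mathcal{F}}(P)=\mathcal{F}(P,P)$; and, for each $Q\leq S$ and each isomorphism $\varphi:Q\to P$ in $\mathcal{F}$, $\varphi$ extends to a morphism in $\mathcal{F}(N_\varphi,S)$, where $N_\varphi=\{g\in N_S(Q)\mid \varphi c_g\varphi^{-1}\in \mathrm{Aut}_S(P)\}$ and $c_g(x)=gxg^{-1}$. Burnside rings. $A_+(S)$ is the semiring of isomorphism classes of finite $S$-sets (disjoint union and cartesian product), and the Burnside ring $A(S)$ is its Grothendieck ring. For $P\leq S$, $\Phi_P:A(S)\to\mathbb{Z}$ is the ring homomorphism with $\Phi_P([X])=|X^P|$ (number of $P$-fixed points) for each finite $S$-set $X$. An element $X\in A(S)$ is $\mathcal{F}$-stable if for every $P\leq S$ and $\varphi\in\mathcal{F}(P,S)$ the restrictions of $X$ to $A(P)$ along $\varphi$ and along the inclusion $P\hookrightarrow S$ coincide; equivalently $\Phi_P(X)=\Phi_Q(X)$ whenever $P\sim_{\mathcal{F}}Q$. The $\mathcal{F}$-stable elements form a subring $A(\mathcal{F})$ of $A(S)$, the Burnside ring of $\mathcal{F}$. Ideals. For $P\leq S$ and $q$ a prime, $\mathcal{I}_{P,q}=\{X\in A(\mathcal{F})\mid\Phi_P(X)\equiv0\bmod q\}$, and $\mathcal{I}_{P,0}=\{X\in A(\mathcal{F})\mid\Phi_P(X)=0\}$. These are prime ideals of $A(\mathcal{F})$. For every $P\leq S$ one has $\mathcal{I}_{P,p}=\mathcal{I}_{S,p}$,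 which is why the convention is to write this ideal only as $\mathcal{I}_{S,p}$. *)

(* Defs.v *)
From HB Require Import structures.
From mathcomp Require Import all_boot all_order all_algebra all_fingroup.
From mathcomp Require Import all_solvable.
From mathcomp Require Import boolp generic_quotient.

Set Implicit Arguments.
Unset Strict Implicit.
Unset Printing Implicit Defensive.

Import GRing.Theory.

Local Open Scope ring_scope.
Local Open Scope quotient_scope.

(******************************************************************************)
(*   groth R         == the Grothendieck ring of a commutative semiring R     *)
(*   groth_in        == the canonical semiring morphism R -> groth R          *)
(*   groth_lift f    == the extension to groth R of a semiring morphism f     *)
(*                      from R to a commutative ring                          *)
(*   gset G          == finite G-sets with carrier some 'I_n                  *)
(*   gset_iso        == isomorphism of G-sets                                 *)
(*   burnside_semi G == A_+(G), isomorphism classes of finite G-sets          *)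
(*   gclass to       == [X] \in A_+(G), for an action to of G on X            *)
(*   burnside G      == A(G)                                                  *)
(*   mark P          == Phi_P : A(G) -> int                                   *)
(*   res f           == the restriction A(G) -> A(H) along f : H -> G         *)
(*   fhom F P Q f    == the restriction of f to P belongs to F(P, Q)          *)
(*   fusion_isomorphic F P Q == P and Q are isomorphic in F                   *)
(*   fusion_Aut F P  == Aut_F(P), as a group of permutations of gT            *)
(*   inner_Aut P     == Aut_S(P)                                              *)
(*   extender Q P f  == N_f, for an isomorphism f : Q -> P in F               *)
(*   fusion_saturated F p == F is saturated (with respect to p)               *)
(*   stable F        == the F-stable elements of A(S)                         *)
(*   burnside_fusion F == A(F), the subring of stable elements of A(S)        *)
(*   fideal F P q    == I_{P,q}                                               *)
(* The group S is the full group [set: gT] of a finGroupType gT. As in the    *)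
(* rest of the library, group actions are right actions; a left action        *)
(* corresponds to the right action x . g := g^-1 x, with the same             *)
(* isomorphisms, fixed points and restrictions.                               *)
(******************************************************************************)

Section Grothendieck.

Variable R : comPzSemiRingType.
Implicit Types x y z : R * R.

(* (a, b) stands for a - b. *)
Definition groth_rel x y : bool :=
  `[< exists c, x.1 + y.2 + c = y.1 + x.2 + c >].

Lemma groth_refl : reflexive groth_rel.
Proof. by move=> x; apply/asboolP; exists 0. Qed.

Lemma groth_sym : symmetric groth_rel.
Proof.
by move=> x y; apply/asboolP/asboolP => -[c e]; exists c; rewrite e.
Qed.

Lemma groth_trans : transitive groth_rel.
Proof.
move=> y x z /asboolP[c e] /asboolP[d f]; apply/asboolP.
exists (c + d + y.1 + y.2).
have -> : x.1 + z.2 + (c + d + y.1 + y.2) =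
          (x.1 + y.2 + c) + (y.1 + z.2 + d).
  by rewrite (AC (2*4) ((1*6*3)*(5*2*4))).
rewrite e f.
by rewrite (AC (3*3) ((4*2)*(3*6*1*5))).
Qed.

Canonical groth_equiv := EquivRel groth_rel groth_refl groth_sym groth_trans.

Definition groth := {eq_quot groth_equiv}.
HB.instance Definition _ := Choice.on groth.
HB.instance Definition _ := EqQuotient.on groth.

Definition groth_pair x : groth := \pi x.

Lemma groth_pairP x y :
  groth_pair x = groth_pair y <-> exists c, x.1 + y.2 + c = y.1 + x.2 + c.
Proof.
split; first by move=> /eqmodP/asboolP.
by move=> h; apply/eqmodP/asboolP.
Qed.

Lemma groth_ind (P : groth -> Prop) :
  (forall x, P (groth_pair x)) -> forall X, P X.
Proof. by move=> h; elim/quotW. Qed.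

Lemma groth_repr X : groth_pair (repr X) = X.
Proof. exact: reprK. Qed.

Lemma groth_repr_pair x :
  exists c, (repr (groth_pair x)).1 + x.2 + c = x.1 + (repr (groth_pair x)).2 + c.
Proof. by apply/groth_pairP; rewrite groth_repr. Qed.

Definition groth_add (X Y : groth) : groth :=
  let x := repr X in let y := repr Y in groth_pair (x.1 + y.1, x.2 + y.2).

Definition groth_opp (X : groth) : groth :=
  let x := repr X in groth_pair (x.2, x.1).

Definition groth_mul (X Y : groth) : groth :=
  let x := repr X in let y := repr Y in
  groth_pair (x.1 * y.1 + x.2 * y.2, x.1 * y.2 + x.2 * y.1).

Lemma groth_addE x y :
  groth_add (groth_pair x) (groth_pair y) = groth_pair (x.1 + y.1, x.2 + y.2).
Proof.
rewrite /groth_add; apply/groth_pairP => /=.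
have [c e] := groth_repr_pair x; have [d f] := groth_repr_pair y.
set u := repr (groth_pair x) in e *; set v := repr (groth_pair y) in f *.
exists (c + d).
transitivity ((u.1 + x.2 + c) + (v.1 + y.2 + d)).
  by rewrite (AC (2*2*2) ((1*3*5)*(2*4*6))).
by rewrite e f (AC (3*3) ((1*4)*(2*5)*(3*6))).
Qed.

Lemma groth_oppE x : groth_opp (groth_pair x) = groth_pair (x.2, x.1).
Proof.
rewrite /groth_opp; apply/groth_pairP => /=.
have [c e] := groth_repr_pair x; exists c.
by rewrite [X in X + c]addrC -e [X in _ = X + c]addrC.
Qed.

Lemma groth_mulE x y :
  groth_mul (groth_pair x) (groth_pair y) =
  groth_pair (x.1 * y.1 + x.2 * y.2, x.1 * y.2 + x.2 * y.1).
Proof.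
have mull (u v w : R * R) : groth_pair u = groth_pair v ->
  groth_pair (u.1 * w.1 + u.2 * w.2, u.1 * w.2 + u.2 * w.1) =
  groth_pair (v.1 * w.1 + v.2 * w.2, v.1 * w.2 + v.2 * w.1).
  move=> /groth_pairP[c e]; apply/groth_pairP; exists (c * w.1 + c * w.2) => /=.
  transitivity ((u.1 + v.2 + c) * w.1 + (v.1 + u.2 + c) * w.2).
    rewrite !mulrDl.
    by rewrite (AC (2*2*2) ((1*4*5)*(3*2*6))).
  rewrite [in X in X + _]e -[in X in _ + X]e !mulrDl.
  by rewrite (AC (3*3) ((1*5)*(4*2)*(3*6))).
have mulc (u v : R * R) :
  (u.1 * v.1 + u.2 * v.2, u.1 * v.2 + u.2 * v.1) =
  (v.1 * u.1 + v.2 * u.2, v.1 * u.2 + v.2 * u.1).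
  by rewrite mulrC [u.2 * _]mulrC [u.1 * v.2]mulrC [u.2 * _]mulrC
             [v.2 * _ + _]addrC.
rewrite /groth_mul (mull _ x) ?groth_repr //.
by rewrite mulc (mull _ y) ?groth_repr // mulc.
Qed.

Fact groth_addA : associative groth_add.
Proof.
elim/groth_ind=> x; elim/groth_ind=> y; elim/groth_ind=> z.
by rewrite !groth_addE /= !addrA.
Qed.

Fact groth_addC : commutative groth_add.
Proof.
elim/groth_ind=> x; elim/groth_ind=> y.
by rewrite !groth_addE addrC [x.2 + _]addrC.
Qed.

Fact groth_add0 : left_id (groth_pair (0, 0)) groth_add.
Proof. by elim/groth_ind=> -[a b]; rewrite groth_addE /= !add0r. Qed.

Fact groth_addN : left_inverse (groth_pair (0, 0)) groth_opp groth_add.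
Proof.
elim/groth_ind=> x; rewrite groth_oppE groth_addE; apply/groth_pairP.
by exists 0; rewrite /= !addr0 add0r addrC.
Qed.

HB.instance Definition _ :=
  GRing.isZmodule.Build groth groth_addA groth_addC groth_add0 groth_addN.

Fact groth_mulA : associative groth_mul.
Proof.
elim/groth_ind=> x; elim/groth_ind=> y; elim/groth_ind=> z.
rewrite !groth_mulE /= !mulrDl !mulrDr !mulrA.
by congr (groth_pair (_, _)); rewrite (AC (2*2) ((1*4)*(2*3))) //
   (AC (2*2) ((1*4)*(3*2))).
Qed.

Fact groth_mulC : commutative groth_mul.
Proof.
elim/groth_ind=> x; elim/groth_ind=> y; rewrite !groth_mulE.
by rewrite mulrC [x.2 * _]mulrC [x.1 * y.2]mulrC [x.2 * _]mulrC
           [y.2 * _ + _]addrC.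
Qed.

Fact groth_mul1 : left_id (groth_pair (1, 0)) groth_mul.
Proof.
by elim/groth_ind=> -[a b]; rewrite groth_mulE /= !mul1r !mul0r !addr0.
Qed.

Fact groth_mulDl : left_distributive groth_mul +%R.
Proof.
elim/groth_ind=> x; elim/groth_ind=> y; elim/groth_ind=> z.
rewrite /GRing.add /= groth_addE !groth_mulE groth_addE /= !mulrDl.
by congr (groth_pair (_, _)); rewrite (AC (2*2) ((1*3)*(2*4))).
Qed.

HB.instance Definition _ := GRing.Zmodule_isComPzRing.Build groth
  groth_mulA groth_mulC groth_mul1 groth_mulDl.

Definition groth_in (a : R) : groth := groth_pair (a, 0).

Fact groth_in_nmod_morphism : nmod_morphism groth_in.
Proof.
split=> // a b; rewrite /groth_in [RHS]groth_addE /=.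
by rewrite addr0.
Qed.

Fact groth_in_monoid_morphism : monoid_morphism groth_in.
Proof.
split=> // a b; rewrite /groth_in [RHS]groth_mulE /=.
by rewrite !mulr0 mul0r !addr0.
Qed.

HB.instance Definition _ :=
  GRing.isNmodMorphism.Build R groth groth_in groth_in_nmod_morphism.
HB.instance Definition _ :=
  GRing.isMonoidMorphism.Build R groth groth_in groth_in_monoid_morphism.

Lemma groth_pairE x : groth_pair x = groth_in x.1 - groth_in x.2.
Proof.
rewrite /groth_in /GRing.add /GRing.opp /= groth_oppE groth_addE /=.
by rewrite addr0 add0r; case: x.
Qed.

End Grothendieck.

Section GrothendieckLift.

Variables (R : comPzSemiRingType) (R' : comPzRingType) (f : {rmorphism R -> R'}).

Definition groth_lift (X : groth R) : R' := f (repr X).1 - f (repr X).2.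

Lemma groth_lift_pair x : groth_lift (groth_pair x) = f x.1 - f x.2.
Proof.
have [c /(congr1 f)] := groth_repr_pair x.
rewrite /groth_lift; set u := repr _; rewrite !rmorphD => /addIr e.
by apply/eqP; rewrite subr_eq addrAC eq_sym subr_eq -e.
Qed.

Lemma groth_liftE a : groth_lift (groth_in a) = f a.
Proof. by rewrite groth_lift_pair /= rmorph0 subr0. Qed.

Fact groth_lift_zmod_morphism : zmod_morphism groth_lift.
Proof.
elim/groth_ind=> x; elim/groth_ind=> y.
have -> : groth_pair x - groth_pair y = groth_pair (x.1 + y.2, x.2 + y.1).
  by rewrite [in LHS]/GRing.add [in LHS]/GRing.opp /= groth_oppE groth_addE.
rewrite !groth_lift_pair /= !rmorphD.
by rewrite opprB opprD addrACA.
Qed.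

Fact groth_lift_monoid_morphism : monoid_morphism groth_lift.
Proof.
split; first by rewrite groth_liftE rmorph1.
elim/groth_ind=> x; elim/groth_ind=> y.
rewrite [X in groth_lift X]groth_mulE !groth_lift_pair /= !rmorphD !rmorphM.
by rewrite mulrBl !mulrBr opprD opprB addrACA.
Qed.

HB.instance Definition _ := GRing.isZmodMorphism.Build (groth R) R' groth_lift
  groth_lift_zmod_morphism.
HB.instance Definition _ := GRing.isMonoidMorphism.Build (groth R) R' groth_lift
  groth_lift_monoid_morphism.

End GrothendieckLift.

Section FiniteSets.

Variable G : finGroupType.
Implicit Types T U V : finType.

Definition gset_iso (T U : finType)
    (to : {action G &-> T}) (to' : {action G &-> U}) : Prop :=
  exists2 f : T -> U, bijective f & morph_act to to' f id.

Lemma gset_iso_refl T (to : {action G &-> T}) : gset_iso to to.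
Proof. by exists id => //; exists id. Qed.

Lemma gset_iso_sym T U (to : {action G &-> T}) (to' : {action G &-> U}) :
  gset_iso to to' -> gset_iso to' to.
Proof.
move=> [f [g fK gK] fM]; exists g => [|x a]; first by exists f.
by apply: (can_inj fK); rewrite gK fM gK.
Qed.

Lemma gset_iso_trans T U V (to : {action G &-> T}) (to' : {action G &-> U})
    (to'' : {action G &-> V}) :
  gset_iso to to' -> gset_iso to' to'' -> gset_iso to to''.
Proof.
move=> [f bf fM] [g bg gM]; exists (g \o f) => [|x a /=]; first exact: bij_comp.
by rewrite fM gM.
Qed.

(* Isomorphism classes of finite G-sets are taken over the G-sets carried by  *)
(* some 'I_n, so as to stay in a small type; gclass below is defined for an   *)
(* arbitrary finite carrier.                                                  *)
Definition gset : Type := {n : nat & {action G &-> 'I_n}}.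
HB.instance Definition _ := gen_eqMixin gset.
HB.instance Definition _ := gen_choiceMixin gset.

Definition gset_equiv (X Y : gset) : bool := `[< gset_iso (tagged X) (tagged Y) >].

Lemma gset_equiv_refl : reflexive gset_equiv.
Proof. by move=> X; apply/asboolP/gset_iso_refl. Qed.

Lemma gset_equiv_sym : symmetric gset_equiv.
Proof. by move=> X Y; apply/asboolP/asboolP; apply: gset_iso_sym. Qed.

Lemma gset_equiv_trans : transitive gset_equiv.
Proof.
by move=> Y X Z /asboolP h /asboolP k; apply/asboolP/(gset_iso_trans h k).
Qed.

Canonical gset_equivRel :=
  EquivRel gset_equiv gset_equiv_refl gset_equiv_sym gset_equiv_trans.

Definition burnside_semi := {eq_quot gset_equivRel}.
HB.instance Definition _ := Choice.on burnside_semi.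
HB.instance Definition _ := EqQuotient.on burnside_semi.

Section Transport.

Variables (T U : finType) (to : {action G &-> T}) (f : T -> U) (g : U -> T).
Hypotheses (fK : cancel f g) (gK : cancel g f).

Definition transport_fun (x : U) (a : G) : U := f (to (g x) a).

Fact transport_is_action : is_action setT transport_fun.
Proof.
split=> [a x y /(can_inj fK)/act_inj/(can_inj gK) // | x a b _ _].
by rewrite /transport_fun fK actM.
Qed.

Definition transport : {action G &-> U} := Action transport_is_action.

Lemma transport_iso : gset_iso to transport.
Proof.
by exists f => [|x a]; [exists g | rewrite /= /transport_fun fK].
Qed.

End Transport.

Definition gset_of T (to : {action G &-> T}) : gset :=
  existT _ #|T| (transport to (@enum_rankK T) (@enum_valK T)).

Definition gclass T (to : {action G &-> T}) : burnside_semi :=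
  \pi_burnside_semi (gset_of to).

Lemma gclassP T U (to : {action G &-> T}) (to' : {action G &-> U}) :
  gclass to = gclass to' <-> gset_iso to to'.
Proof.
split=> [/eqmodP/asboolP /= h | h].
  apply: gset_iso_trans (transport_iso to (@enum_rankK T) (@enum_valK T)) _.
  apply: gset_iso_trans h _; exact/gset_iso_sym/transport_iso.
apply/eqmodP/asboolP => /=.
apply: gset_iso_trans (gset_iso_trans h (transport_iso _ _ _)).
exact/gset_iso_sym/transport_iso.
Qed.

Lemma gclass_repr x : gclass (tagged (repr x)) = x.
Proof.
rewrite -[RHS]reprK; apply/eqmodP/asboolP => /=.
exact/gset_iso_sym/transport_iso.
Qed.

Lemma gclass_repr_iso T (to : {action G &-> T}) :
  gset_iso (tagged (repr (gclass to))) to.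
Proof. by apply/gclassP; rewrite gclass_repr. Qed.

Lemma gclass_ind (Q : burnside_semi -> Prop) :
  (forall n (to : {action G &-> 'I_n}), Q (gclass to)) -> forall x, Q x.
Proof. by move=> h x; rewrite -[x]gclass_repr. Qed.

Section Operations.

Variables (T U : finType) (to : {action G &-> T}) (to' : {action G &-> U}).

Definition sum_fun (x : T + U) (a : G) : T + U :=
  match x with inl y => inl (to y a) | inr z => inr (to' z a) end.

Fact sum_is_action : is_action setT sum_fun.
Proof.
split=> [a [x|x] [y|y] //= [] /act_inj -> // | [x|x] a b _ _ /=];
by rewrite actM.
Qed.

Definition sum_act : {action G &-> T + U} := Action sum_is_action.

Definition prod_fun (x : T * U) (a : G) : T * U := (to x.1 a, to' x.2 a).

Fact prod_is_action : is_action setT prod_fun.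
Proof.
split=> [a [x y] [x' y'] [] /act_inj -> /act_inj -> // | x a b _ _].
by rewrite /prod_fun /= !actM.
Qed.

Definition prod_act : {action G &-> T * U} := Action prod_is_action.

End Operations.

Fact trivial_is_action (T : Type) :
  is_action [set: G] (fun (x : T) (_ : G) => x).
Proof. by split=> [a x y|]. Qed.

Definition trivial_act (T : Type) : {action G &-> T} :=
  Action (trivial_is_action T).

Definition bs_add (x y : burnside_semi) : burnside_semi :=
  gclass (sum_act (tagged (repr x)) (tagged (repr y))).

Definition bs_mul (x y : burnside_semi) : burnside_semi :=
  gclass (prod_act (tagged (repr x)) (tagged (repr y))).

Lemma bs_addE T U (to : {action G &-> T}) (to' : {action G &-> U}) :
  bs_add (gclass to) (gclass to') = gclass (sum_act to to').
Proof.
apply/gclassP.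
have [f [f' fK f'K] fM] := gclass_repr_iso to.
have [g [g' gK g'K] gM] := gclass_repr_iso to'.
exists (fun x => match x with inl y => inl (f y) | inr z => inr (g z) end).
  exists (fun x => match x with inl y => inl (f' y) | inr z => inr (g' z) end);
  by case=> x /=; rewrite ?fK ?gK ?f'K ?g'K.
by case=> x a /=; rewrite ?fM ?gM.
Qed.

Lemma bs_mulE T U (to : {action G &-> T}) (to' : {action G &-> U}) :
  bs_mul (gclass to) (gclass to') = gclass (prod_act to to').
Proof.
apply/gclassP.
have [f [f' fK f'K] fM] := gclass_repr_iso to.
have [g [g' gK g'K] gM] := gclass_repr_iso to'.
exists (fun x => (f x.1, g x.2)).
  exists (fun x => (f' x.1, g' x.2));
  by case=> x y /=; rewrite ?fK ?gK ?f'K ?g'K.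
by case=> x y a /=; rewrite /prod_fun /= fM gM.
Qed.

Fact bs_addA : associative bs_add.
Proof.
elim/gclass_ind=> m to; elim/gclass_ind=> n to1; elim/gclass_ind=> k to2.
rewrite !bs_addE; apply/gclassP.
exists (fun x => match x with
  inl y => inl (inl y) | inr (inl z) => inl (inr z) | inr (inr t) => inr t end).
  exists (fun x => match x with
    inl (inl y) => inl y | inl (inr z) => inr (inl z) | inr t => inr (inr t)
    end); by [case=> [x|[x|x]] | case=> [[x|x]|x]].
by case=> [x|[x|x]] a.
Qed.

Fact bs_addC : commutative bs_add.
Proof.
elim/gclass_ind=> m to; elim/gclass_ind=> n to1.
rewrite !bs_addE; apply/gclassP.
exists (fun x => match x with inl y => inr y | inr z => inl z end).
  by exists (fun x => match x with inl y => inr y | inr z => inl z end); case.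
by case.
Qed.

Fact bs_add0 : left_id (gclass (trivial_act void)) bs_add.
Proof.
elim/gclass_ind=> m to; rewrite bs_addE; apply/gclassP.
exists (fun x : void + 'I_m => match x with inl y => of_void _ y | inr z => z end).
  by exists inr => // -[[]|].
by case=> [[]|].
Qed.

HB.instance Definition _ :=
  GRing.isNmodule.Build burnside_semi bs_addA bs_addC bs_add0.

Fact bs_mulA : associative bs_mul.
Proof.
elim/gclass_ind=> m to; elim/gclass_ind=> n to1; elim/gclass_ind=> k to2.
rewrite !bs_mulE; apply/gclassP.
exists (fun x => ((x.1, x.2.1), x.2.2)) => //.
by exists (fun x => (x.1.1, (x.1.2, x.2))); [case=> x [] | case=> [[]]].
Qed.

Fact bs_mulC : commutative bs_mul.
Proof.
elim/gclass_ind=> m to; elim/gclass_ind=> n to1.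
rewrite !bs_mulE; apply/gclassP.
by exists (fun x => (x.2, x.1)) => //; exists (fun x => (x.2, x.1)); case.
Qed.

Fact bs_mul1 : left_id (gclass (trivial_act unit)) bs_mul.
Proof.
elim/gclass_ind=> m to; rewrite bs_mulE; apply/gclassP.
by exists snd => //; exists (pair tt) => // -[[]].
Qed.

Fact bs_mulDl : left_distributive bs_mul bs_add.
Proof.
elim/gclass_ind=> m to; elim/gclass_ind=> n to1; elim/gclass_ind=> k to2.
rewrite bs_addE !bs_mulE bs_addE; apply/gclassP.
exists (fun x => match x with
  (inl y, t) => inl (y, t) | (inr z, t) => inr (z, t) end).
  by exists (fun x => match x with
    inl (y, t) => (inl y, t) | inr (z, t) => (inr z, t) end); [case=> [[x|x] t] | case=> [[x t]|[x t]]].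
by case=> [[x|x] t].
Qed.

Fact bs_mul0 : left_zero (gclass (trivial_act void)) bs_mul.
Proof.
elim/gclass_ind=> m to; rewrite bs_mulE; apply/gclassP.
by exists fst => [|[[]]]; exists (of_void _); [case=> [[]] | case].
Qed.

HB.instance Definition _ := GRing.Nmodule_isComPzSemiRing.Build burnside_semi
  bs_mulA bs_mulC bs_mul1 bs_mulDl bs_mul0.

Section Marks.

Variable P : {group G}.

(* |X^P| *)
Definition fixcard (x : burnside_semi) : int :=
  #|('Fix_(tagged (repr x))(P))%g|%:Z.

Lemma card_fix_iso T U (to : {action G &-> T}) (to' : {action G &-> U}) :
  gset_iso to to' -> #|('Fix_to(P))%g| = #|('Fix_to'(P))%g|.
Proof.
move=> [f [g fK gK] fM]; rewrite -(card_imset _ (can_inj fK)).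
congr #|pred_of_set _|; apply/setP=> y; apply/imsetP/afixP => [[x /afixP hx ->] a Pa|hy].
  by rewrite -fM hx.
exists (g y); rewrite ?gK //; apply/afixP=> a Pa.
by apply: (can_inj fK); rewrite fM gK hy.
Qed.

Lemma fixcardE T (to : {action G &-> T}) : fixcard (gclass to) = #|('Fix_to(P))%g|%:Z.
Proof. by congr Posz; apply/card_fix_iso/gclass_repr_iso. Qed.

Lemma fix_trivial (T : finType) : ('Fix_(trivial_act T)(P))%g = [set: T].
Proof. by apply/setP=> x; rewrite [RHS]inE; apply/afixP. Qed.

Fact fixcard_nmod_morphism : nmod_morphism fixcard.
Proof.
split; first by rewrite fixcardE fix_trivial cardsT card_void.
elim/gclass_ind=> m to; elim/gclass_ind=> n to1.
rewrite [X in fixcard X]bs_addE !fixcardE -PoszD; congr Posz.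
rewrite -!sum1_card big_sumType /=.
by congr (_ + _)%N; apply: eq_bigl => x;
   (apply/afixP/afixP=> h a /h /=; [case | move=> ->]).
Qed.

Fact fixcard_monoid_morphism : monoid_morphism fixcard.
Proof.
split; first by rewrite fixcardE fix_trivial cardsT card_unit.
elim/gclass_ind=> m to; elim/gclass_ind=> n to1.
rewrite [X in fixcard X]bs_mulE !fixcardE -PoszM -cardsX; congr (Posz #|pred_of_set _|).
apply/setP=> -[x y]; rewrite in_setX; apply/afixP/andP => [h|[/afixP h /afixP k] a Pa].
  by split; apply/afixP=> a /h [].
by rewrite /= /prod_fun /= h ?k.
Qed.

HB.instance Definition _ := GRing.isNmodMorphism.Build burnside_semi int fixcard
  fixcard_nmod_morphism.
HB.instance Definition _ := GRing.isMonoidMorphism.Build burnside_semi int fixcard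
  fixcard_monoid_morphism.

End Marks.

Definition burnside := groth burnside_semi.
HB.instance Definition _ := GRing.ComPzRing.on burnside.

Definition burnside_class (T : finType) (to : {action G &-> T}) : burnside :=
  groth_in (gclass to).

Definition mark (P : {group G}) : burnside -> int := groth_lift (fixcard P).
HB.instance Definition _ P := GRing.RMorphism.on (mark P).

Lemma mark_class P T (to : {action G &-> T}) :
  mark P (burnside_class to) = #|('Fix_to(P))%g|%:Z.
Proof. by rewrite /mark groth_liftE /= fixcardE. Qed.

Fact burnside_oner_neq0 : 1 != 0 :> burnside.
Proof.
by apply/eqP=> /(congr1 (mark 1%G))/eqP; rewrite rmorph1 rmorph0.
Qed.

HB.instance Definition _ :=
  GRing.PzSemiRing_isNonZero.Build burnside burnside_oner_neq0.

End FiniteSets.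

Section Restriction.

Variables (G H : finGroupType) (f : {morphism [set: H] >-> G}).
Implicit Types T U : finType.

Section Action.

Variables (T : finType) (to : {action G &-> T}).

Fact res_is_action : is_action [set: H] (fun x h => to x (f h)).
Proof.
split=> [a x y /act_inj // | x a b _ _].
by rewrite morphM ?inE // actM.
Qed.

Definition res_act : {action H &-> T} := Action res_is_action.

End Action.

Lemma res_act_iso T U (to : {action G &-> T}) (to' : {action G &-> U}) :
  gset_iso to to' -> gset_iso (res_act to) (res_act to').
Proof. by move=> [g bg gM]; exists g => // x a /=; rewrite gM. Qed.

Definition res_semi (x : burnside_semi G) : burnside_semi H :=
  gclass (res_act (tagged (repr x))).

Lemma res_semiE T (to : {action G &-> T}) :
  res_semi (gclass to) = gclass (res_act to).
Proof. exact/gclassP/res_act_iso/gclass_repr_iso. Qed.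

Fact res_semi_nmod_morphism : nmod_morphism res_semi.
Proof.
split; first by rewrite res_semiE; apply/gclassP; exists id => //; exists id.
elim/gclass_ind=> m to; elim/gclass_ind=> n to1.
rewrite [X in res_semi X]bs_addE !res_semiE [RHS]bs_addE.
by apply/gclassP; exists id => [|[]]; first exists id.
Qed.

Fact res_semi_monoid_morphism : monoid_morphism res_semi.
Proof.
split; first by rewrite res_semiE; apply/gclassP; exists id => //; exists id.
elim/gclass_ind=> m to; elim/gclass_ind=> n to1.
rewrite [X in res_semi X]bs_mulE !res_semiE [RHS]bs_mulE.
by apply/gclassP; exists id => //; exists id.
Qed.

HB.instance Definition _ := GRing.isNmodMorphism.Build
  (burnside_semi G) (burnside_semi H) res_semi res_semi_nmod_morphism.
HB.instance Definition _ := GRing.isMonoidMorphism.Build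
  (burnside_semi G) (burnside_semi H) res_semi res_semi_monoid_morphism.

Definition res : burnside G -> burnside H :=
  groth_lift (@groth_in (burnside_semi H) \o res_semi).
HB.instance Definition _ := GRing.RMorphism.on res.

Lemma res_class T (to : {action G &-> T}) :
  res (burnside_class to) = burnside_class (res_act to).
Proof. by rewrite /res groth_liftE /= res_semiE. Qed.

End Restriction.

(* A morphism P -> Q is represented by any function on gT extending it:       *)
(* fhom P Q f means that the restriction of f to P belongs to F(P, Q), and    *)
(* fhom_ext says that this depends only on that restriction.                  *)
Record fusion_system (gT : finGroupType) := FusionSystem {
  fhom : {group gT} -> {group gT} -> pred (gT -> gT);
  fhom_ext : forall (P Q : {group gT}) (f g : gT -> gT),
    {in P, f =1 g} -> fhom P Q f = fhom P Q g;
  fhom_id : forall P : {group gT}, fhom P P id;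
  fhom_comp : forall (P Q R : {group gT}) (f g : gT -> gT),
    fhom P Q f -> fhom Q R g -> fhom P R (g \o f);
  fhom_inj : forall (P Q : {group gT}) (f : gT -> gT), fhom P Q f ->
    [/\ {in P &, {morph f : x y / (x * y)%g}}, {in P &, injective f}
      & f @: P \subset Q];
  fhom_conj : forall s (P Q : {group gT}), (P :^ s^-1 \subset Q)%g ->
    fhom P Q (fun x => (s * x * s^-1)%g);
  fhom_im : forall (P Q R : {group gT}) (f : gT -> gT),
    fhom P Q f -> f @: P = R -> fhom P R f;
  fhom_inv : forall (P Q R : {group gT}) (f g : gT -> gT),
    fhom P Q f -> f @: P = R -> {in P, cancel f g} -> fhom R P g
}.

Section Fusion.

Variables (gT : finGroupType) (F : fusion_system gT).
Implicit Types P Q : {group gT}.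

Definition fusion_iso P Q (f : gT -> gT) : Prop :=
  fhom F P Q f /\
  exists g, [/\ fhom F Q P g, {in P, cancel f g} & {in Q, cancel g f}].

Definition fusion_isomorphic P Q : Prop := exists f, fusion_iso P Q f.

Definition fusion_Aut P : {set {perm gT}} := [set a in Aut P | fhom F P P a].

Fact fusion_Aut_group_set P : group_set (fusion_Aut P).
Proof.
apply/group_setP; split=> [|a b].
  rewrite inE group1 /= (@fhom_ext _ F P P _ id) ?fhom_id // => x _.
  by rewrite perm1.
move=> /setIdP[Aa Fa] /setIdP[Ab Fb]; rewrite inE groupM //=.
rewrite (@fhom_ext _ F P P _ (b \o a)) ?(fhom_comp Fa Fb) // => x _.
by rewrite permM.
Qed.
Canonical fusion_Aut_group P := Group (fusion_Aut_group_set P).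

(* Aut_S(P) for S = [set: gT]; conj_aut P g is x |-> g^-1 x g, which gives    *)
(* the same set of automorphisms as x |-> g x g^-1.                           *)
Definition inner_Aut P : {set {perm gT}} := (conj_aut P @* 'N(P))%g.
Canonical inner_Aut_group P := [group of inner_Aut P].

(* phi \o c_g = a \o phi on Q says that phi c_g phi^-1 = a on P. *)
Definition extender Q P (phi : gT -> gT) : {set gT} :=
  [set g in 'N(Q)%g | [exists a in inner_Aut P,
     [forall x in Q, phi (g * x * g^-1)%g == a (phi x)]]].

Fact extender_group_set Q P phi : group_set (extender Q P phi).
Proof.
apply/group_setP; split=> [|g h].
  rewrite inE group1 /=; apply/existsP; exists 1%g.
  by rewrite group1; apply/forall_inP=> x _; rewrite mul1g invg1 mulg1 perm1.
case/setIdP=> Ng /existsP[a /andP[Aa /forall_inP ha]].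
case/setIdP=> Nh /existsP[b /andP[Ab /forall_inP hb]].
rewrite inE groupM //=; apply/existsP; exists (b * a)%g; rewrite groupM //=.
apply/forall_inP=> x Qx; rewrite permM -(eqP (hb x Qx)).
have Qhx : (h * x * h^-1)%g \in Q.
  by have := memJ_norm x (groupVr Nh); rewrite conjgE invgK mulgA Qx.
by rewrite -(eqP (ha _ Qhx)) invMg !mulgA.
Qed.
Canonical extender_group Q P phi := Group (extender_group_set Q P phi).

Definition fusion_saturated (p : nat) : Prop :=
  forall P0 : {group gT}, exists P,
    [/\ fusion_isomorphic P0 P,
        (p.-Sylow(fusion_Aut P) (inner_Aut P))%g
      & forall Q phi, fusion_iso Q P phi ->
          exists2 psi, fhom F (extender_group Q P phi) [set: gT]%G psi
                     & {in Q, psi =1 phi}].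

Fact comp_sgval_morphM P (f : {morphism P >-> gT}) :
  {in [set: subg_of P] &, {morph f \o sgval : x y / (x * y)%g}}.
Proof. by move=> x y _ _; rewrite /= morphM ?subgP. Qed.

Definition comp_sgval P (f : {morphism P >-> gT}) :
  {morphism [set: subg_of P] >-> gT} := Morphism (comp_sgval_morphM f).

Definition stable : {pred burnside gT} := fun X =>
  `[< forall P (f : {morphism P >-> gT}), fhom F P [set: gT]%G f ->
      res (comp_sgval f) X = res (sgval_morphism P) X >].

Fact stable_subring_closed : subring_closed stable.
Proof.
split=> [|X Y /asboolP hX /asboolP hY|X Y /asboolP hX /asboolP hY];
  apply/asboolP=> P f Ff.
- by rewrite !rmorph1.
- by rewrite !rmorphB /= (hX _ _ Ff) (hY _ _ Ff).
- by rewrite !rmorphM /= (hX _ _ Ff) (hY _ _ Ff).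
Qed.

HB.instance Definition _ :=
  GRing.isSubringClosed.Build (burnside gT) stable stable_subring_closed.

Record burnside_fusion : predArgType :=
  BurnsideFusion { bf_val : burnside gT; _ : bf_val \in stable }.

HB.instance Definition _ := [isSub for bf_val].
HB.instance Definition _ := [Choice of burnside_fusion by <:].
HB.instance Definition _ := [SubChoice_isSubComNzRing of burnside_fusion by <:].

(* For q = 0 the condition reads mark P X = 0 (dvd0z). *)
Definition fideal P (q : nat) : {pred burnside_fusion} :=
  [pred X | (q%:Z %| mark P (\val X))%Z].

End Fusion.

Arguments fideal {gT} F P q.

Section Ideals.

Variable R : comNzRingType.
Implicit Types I J : {pred R}.

(* idealr_closed includes 1 \notin I. *)
Definition prime_ideal I : Prop := idealr_closed I /\ prime_idealr_closed I.

Definition minimal_prime_ideal I : Prop :=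
  prime_ideal I /\ forall J, prime_ideal J -> {subset J <= I} -> J =i I.

Definition maximal_ideal I : Prop :=
  idealr_closed I /\ forall J, idealr_closed J -> {subset I <= J} -> J =i I.

End Ideals.

(* Main.v *)
Require Import Defs.
From mathcomp Require Import all_boot all_order all_algebra all_fingroup.
From mathcomp Require Import all_solvable.
From mathcomp Require Import boolp.

(* Let N be the class of subgroups F-isomorphic to P. A suitable power m of p *)
(* times the indicator function of N is the vector of marks of some e in      *)
(* A(S): for Q in N and R outside N, one of [S/Q] and |N(R):R| - [S/R] has    *)
(* mark 0 at R and a power of p at Q, and e is obtained from these by         *)
(* products and complements. Since marks separate the elements of A(S), e is  *)
(* F-stable. It lies in I_{Q,q} for every Q outside N, but not in I_{P,q'}    *)
(* when q' <> p, and X e = 0 for every X in I_{P,0}, which makes I_{P,0}      *)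
(* minimal. At q = p, marks of S-sets are all congruent mod p.                *)

(** Everything is read off from marks. They embed A(S) in a product of copies of Z ([mark_inj]), so
    F-stability is equality of marks along F-isomorphism classes ([stableP]), and each class has an
    element of A(F) equal to a power of p times its indicator ([burnside_fusion_indicator]).

    An inclusion of I_{P,q} in I_{P',q'} forces q' to divide q, by testing on the constant q. For q'
    different from p it also forces P and P' to be F-isomorphic, by testing on the indicator of the
    class of P'. For q' = p, all marks of an element agree mod p ([mark_modp]), whence case (c).
    Maximality for q prime is a Bezout argument: modulo I_{P,q} every element is an integer mod
    q. *)

Section Marks.

Local Set Implicit Arguments.
Local Unset Strict Implicit.

Import GRing.Theory.
Local Open Scope ring_scope.

(** * Finite G-sets are determined by their fixed-point counts *)

Section BurnsideInjectivity.

Variables (G : finGroupType) (T U : finType).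
Variables (to : {action G &-> T}) (to' : {action G &-> U}).

Local Notation orb := (orbit to [set: G]).
Local Notation orb' := (orbit to' [set: G]).

(** The equivariant map sending x.a to y.a, well defined when x and y have the same stabiliser; the
    default 1 only matters for z outside the orbit of x. *)
Definition orbit_map (x : T) (y : U) (z : T) : U :=
  to' y (odflt 1%g [pick a | to x a == z]).

Lemma astab1_eq_act (x : T) (y : U) (a b : G) :
  ('C[x | to] = 'C[y | to'])%g -> (to x a == to x b) = (to' y a == to' y b).
Proof.
have eqact (V : finType) (t : {action G &-> V}) z :
    (t z a == t z b) = ((a * b^-1)%g \in 'C[z | t]%g).
  apply/eqP/astab1P; rewrite actM => h; first by rewrite h actK.
  exact: canRL (actKV _ _) h.
by move=> e; rewrite !eqact e.
Qed.

Lemma orbit_mapE x y a :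
  ('C[x | to] = 'C[y | to'])%g -> orbit_map x y (to x a) = to' y a.
Proof.
move=> e; rewrite /orbit_map.
case: pickP => [b /= | /(_ a)]; last by rewrite eqxx.
by rewrite (astab1_eq_act _ _ e) => /eqP.
Qed.

Lemma orbit_map_inj x y :
  ('C[x | to] = 'C[y | to'])%g -> {in orb x &, injective (orbit_map x y)}.
Proof.
move=> e _ _ /orbitP[a _ <-] /orbitP[b _ <-]; rewrite !orbit_mapE // => /eqP.
by rewrite -(astab1_eq_act _ _ e) => /eqP.
Qed.

(** [orbit_map x y] is an isomorphism between the two orbits. This keeps the fixed-point counts
    equal once both orbits are removed. *)
Lemma card_fix_orbit x y (Q : {group G}) :
  ('C[x | to] = 'C[y | to'])%g ->
  #|('Fix_(orb x | to)(Q))%g| = #|('Fix_(orb' y | to')(Q))%g|.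
Proof.
move=> e; have fixE a : (to x a \in 'Fix_to(Q)%g) = (to' y a \in 'Fix_to'(Q)%g).
  apply/afixP/afixP=> h b /h.
    by rewrite -!actM => /eqP; rewrite (astab1_eq_act _ _ e) => /eqP.
  by rewrite -!actM => /eqP; rewrite -(astab1_eq_act _ _ e) => /eqP.
rewrite -(card_in_imset (f := orbit_map x y)); last first.
  by move=> u v /setIP[ou _] /setIP[ov _]; apply: orbit_map_inj.
congr #|pred_of_set _|; apply/setP=> u; apply/imsetP/setIP.
  case=> z /setIP[/orbitP[a _ <-] fz] ->; rewrite orbit_mapE // -fixE.
  by split=> //; apply/orbitP; exists a; rewrite ?inE.
case=> /orbitP[a _ <-] fu; exists (to x a); last by rewrite orbit_mapE.
by rewrite inE fixE fu andbT; apply/orbitP; exists a; rewrite ?inE.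
Qed.

(* Points with stabiliser of maximal order have the same stabilisers on both  *)
(* sides, so that one orbit can be matched and removed from each.             *)
Lemma equivariant_injection (u0 : U) (A : {set T}) (B : {set U}) :
  (forall x a, (to x a \in A) = (x \in A)) ->
  (forall y a, (to' y a \in B) = (y \in B)) ->
  (forall Q : {group G}, #|('Fix_(A | to)(Q))%g| = #|('Fix_(B | to')(Q))%g|) ->
  exists f : T -> U, [/\ {in A, forall x, f x \in B}, {in A &, injective f}
    & {in A, forall x a, f (to x a) = to' (f x) a}].
Proof.
have [n] := ubnP #|A|; elim: n => // n IHn in A B *.
rewrite ltnS => leAn actA actB cardAB.
have [A0 | [x0 Ax0]] := set_0Vmem A.
  by exists (fun=> u0); split=> [x|x ? |x]; rewrite A0 inE.
have [x /= Ax maxx] :=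
  @arg_maxnP _ x0 (fun x => x \in A) (fun x => #|'C[x | to]%g|) Ax0.
have fixle (Q : {group G}) z :
    z \in ('Fix_(A | to)(Q))%g -> (#|Q| <= #|'C[x | to]%g|)%N.
  case/setIP=> Az fz; apply: leq_trans (maxx z Az).
  by apply: subset_leq_card; rewrite sub_astab1.
have [y /setIP[By fy]] : exists y, y \in ('Fix_(B | to')('C[x | to]))%g.
  apply/card_gt0P; rewrite -(cardAB [group of 'C[x | to]%g]).
  by apply/card_gt0P; exists x; rewrite inE Ax -sub_astab1 subxx.
(* The stabiliser of y contains that of x. It also fixes some z in A, because the counts agree, so
   by maximality its order is at most that of the stabiliser of x. *)
have e : ('C[x | to] = 'C[y | to'])%g.
  apply/eqP; rewrite eqEcard sub_astab1 fy /=.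
  have : (0 < #|('Fix_(A | to)('C[y | to']))%g|)%N.
    rewrite (cardAB [group of 'C[y | to']%g]).
    by apply/card_gt0P; exists y; rewrite inE By -sub_astab1 subxx.
  by case/card_gt0P=> z /(fixle [group of 'C[y | to']%g]).
have oA : orb x \subset A by apply/subsetP=> _ /orbitP[a _ <-]; rewrite actA.
have oB : orb' y \subset B by apply/subsetP=> _ /orbitP[a _ <-]; rewrite actB.
have orb_act (V : finType) (t : {action G &-> V}) v z a :
    (t z a \in orbit t [set: G] v) = (z \in orbit t [set: G] v).
  by apply: (orbit_actr t (G := [set: G]%G)); rewrite inE.
have fixD (V : finType) (t : {action G &-> V}) (C D : {set V}) (Q : {group G}) :
    D \subset C -> #|('Fix_(C :\: D | t)(Q))%g| =
      (#|('Fix_(C | t)(Q))%g| - #|('Fix_(D | t)(Q))%g|)%N.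
  by move=> sDC; rewrite setIDAC cardsD setIAC (setIidPr sDC).
have cardD (Q : {group G}) : #|('Fix_(A :\: orb x | to)(Q))%g| =
                             #|('Fix_(B :\: orb' y | to')(Q))%g|.
  by rewrite !fixD // cardAB (card_fix_orbit _ e).
have [||| f [fB f_inj fM]] := IHn (A :\: orb x) (B :\: orb' y) _ _ _ cardD.
- apply: leq_trans leAn; apply/proper_card/properP.
  split; first exact: subsetDl.
  by exists x => //; rewrite !inE orbit_refl.
- by move=> z a; rewrite !inE actA orb_act.
- by move=> z a; rewrite !inE actB orb_act.
pose h z := if z \in orb x then orbit_map x y z else f z.
have hO z : z \in orb x -> h z \in orb' y.
  rewrite /h => oz; rewrite oz; case/orbitP: oz => a _ <-.
  by rewrite orbit_mapE // mem_orbit ?inE.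
have hD z : z \in A -> z \notin orb x -> h z \in B :\: orb' y.
  by move=> Az nz; rewrite /h (negPf nz); apply: fB; rewrite inE nz.
exists h; split.
- move=> z Az; have [oz | nz] := boolP (z \in orb x).
    exact: subsetP oB _ (hO _ oz).
  by case/setDP: (hD _ Az nz).
- move=> u v Au Av.
  have [ou | nu] := boolP (u \in orb x); have [ov | nv] := boolP (v \in orb x).
  + by rewrite /h ou ov; apply: orbit_map_inj.
  + move=> eh; have := hO _ ou; rewrite eh.
    by case/setDP: (hD _ Av nv) => _ /negPf->.
  + move=> eh; have := hO _ ov; rewrite -eh.
    by case/setDP: (hD _ Au nu) => _ /negPf->.
  + by rewrite /h (negPf nu) (negPf nv); apply: f_inj; rewrite inE ?nu ?nv.
move=> z Az a; rewrite /h orb_act; case: ifPn => [/orbitP[b _ <-] | nz].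
  by rewrite -actM !orbit_mapE // actM.
by apply: fM; rewrite inE nz.
Qed.

End BurnsideInjectivity.

Lemma afix_one (G : finGroupType) (T : finType) (to : {action G &-> T}) :
  ('Fix_to(1))%g = [set: T].
Proof.
by apply/setP=> x; rewrite [RHS]inE; apply/afixP=> _ /set1P->; rewrite act1.
Qed.

Lemma gset_iso_card_fix (G : finGroupType) (T U : finType)
    (to : {action G &-> T}) (to' : {action G &-> U}) :
  (forall Q : {group G}, #|('Fix_to(Q))%g| = #|('Fix_to'(Q))%g|) ->
  gset_iso to to'.
Proof.
move=> cardTU; have cTU : #|T| = #|U|.
  by have := cardTU 1%G; rewrite !afix_one !cardsT.
(* If U is empty then so is T, and the vacuous map is the isomorphism. *)
have [u0 | U0] := pickP (mem U); last first.
  have T0 : T -> False.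
    by move=> t; have := fintype0 t; rewrite cTU; apply; apply: eq_card0.
  exists (fun t => False_rect U (T0 t)) => [|t]; last by case: (T0 t).
  by apply: inj_card_bij; rewrite ?cTU // => t; case: (T0 t).
move=> _; have [|||f [_ f_inj fM]] :=
  @equivariant_injection G T U to to' u0 [set: T] [set: U].
- by move=> x a; rewrite !inE.
- by move=> y a; rewrite !inE.
- by move=> Q; rewrite !setTI.
exists f => [|x a]; last by rewrite fM ?inE.
by apply: inj_card_bij; rewrite ?cTU // => u v; apply: f_inj; rewrite inE.
Qed.

(** * Marks on the Burnside ring and indicator elements *)

Section Burnside.

Variable G : finGroupType.
Implicit Types (P Q R T : {group G}) (X Y : burnside G).

Lemma burnside_ind (K : burnside G -> Prop) :
  (forall m n (to : {action G &-> 'I_m}) (to' : {action G &-> 'I_n}),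
     K (burnside_class to - burnside_class to')) ->
  forall X, K X.
Proof.
move=> h; elim/groth_ind=> -[a b]; rewrite groth_pairE /=.
by elim/gclass_ind: a => m to; elim/gclass_ind: b => n to'; apply: h.
Qed.

Lemma mark_inj X : (forall P, mark P X = 0) -> X = 0.
Proof.
elim/burnside_ind: X => m n to to' h; apply/eqP; rewrite subr_eq0; apply/eqP.
congr groth_in; apply/gclassP/gset_iso_card_fix => Q; apply/eqP.
have := h Q; rewrite rmorphB /= !mark_class -eqz_nat => /eqP.
by rewrite subr_eq0.
Qed.

(** The non-fixed points of a p-group action fall into orbits of size divisible by p. *)
Lemma mark_modp (p : nat) P X :
  (p.-group P)%g -> (p %| mark 1%G X - mark P X)%Z.
Proof.
move=> pP.
have cls n (to : {action G &-> 'I_n}) :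
    (p %| mark 1%G (burnside_class to) - mark P (burnside_class to))%Z.
  rewrite !mark_class -eqz_mod_dvd !modz_nat eqz_nat; apply/eqP.
  rewrite afix_one.
  have actT : [acts P, on [set: 'I_n] | to]%g.
    by apply/subsetP=> a _; apply/astabsP=> x; rewrite !inE.
  by rewrite (pgroup_fix_mod pP actT) setTI.
elim/burnside_ind: X => m n to to'.
rewrite !rmorphB /=; set a := mark 1 _; set b := mark 1 _.
set c := mark P _; set d := mark P _.
have -> : a - b - (c - d) = (a - c) - (b - d) by rewrite !opprD !opprK addrACA.
by rewrite rpredB // /a /b /c /d cls.
Qed.

Section CosetAction.

Variable K : {group G}.

Local Notation coset_carrier := {C : {set G} | C \in rcosets K [set: G]}.

Fact coset_action_dom :
  [set: G] \subset subact_dom (fun C => C \in rcosets K [set: G]) 'Rs%act.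
Proof.
rewrite /subact_dom.
have -> : [set C | C \in rcosets K [set: G]] = rcosets K [set: G].
  by apply/setP=> C; rewrite inE.
exact: (actsRs_rcosets K [set: G]%G).
Qed.

(** The transitive G-set G/K: right cosets of K under right translation. The coset Kx is fixed by R
    exactly when R lies in K^x. *)
Definition coset_action : {action G &-> coset_carrier} :=
  (subaction _ 'Rs \ coset_action_dom)%act.

Lemma mark_coset_action R :
  mark R (burnside_class coset_action) =
  #|('Fix_(rcosets K [set: G] | 'Rs)(R))%g|%:Z.
Proof.
rewrite mark_class; congr Posz; rewrite -(card_imset _ val_inj).
congr #|pred_of_set _|; apply/setP=> C; apply/imsetP/setIP.
  case=> u /afixP fu ->; split; first exact: (valP u).
  apply/afixP=> a Ra; have /(congr1 val) := fu a Ra.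
  by rewrite /= val_subact (subsetP coset_action_dom) ?inE.
case=> KC /afixP fC; exists (Sub C KC) => //; apply/afixP=> a Ra.
by apply: val_inj; rewrite /= val_subact (subsetP coset_action_dom) ?inE //= fC.
Qed.

Lemma mark_coset_eq0 R :
  (forall x, ~~ (R \subset K :^ x)%g) ->
  mark R (burnside_class coset_action) = 0.
Proof.
move=> h; rewrite mark_coset_action; apply/eqP; rewrite eqz_nat cards_eq0.
apply/eqP/setP=> C; rewrite [RHS]inE; apply/negP=> /setIP[/rcosetsP[x _ ->]].
by rewrite sub_afixRs_norms (negPf (h x)).
Qed.

Lemma mark_coset_self :
  mark K (burnside_class coset_action) = #|'N(K) : K|%g%:Z.
Proof.
by rewrite mark_coset_action afixRs_rcosets setTI.
Qed.

End CosetAction.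


Variable p : nat.
Hypothesis pG : (p.-group [set: G])%g.

Lemma pnat_normal_index P : p.-nat #|'N(P) : P|%g.
Proof. exact: pnat_dvd (dvdn_indexg _ _) (pgroupS (subsetT _) pG). Qed.

(** If R lies in a conjugate of Q, then Q lies in no conjugate of R, so [S/R] vanishes at Q and
    subtracting it from the constant |N(R):R| kills only the mark at R. Otherwise [S/Q] itself
    vanishes at R. *)
Lemma separate_nonconj Q R :
  (forall x, R :!=: Q :^ x)%g ->
  exists mX : nat * burnside G,
    [/\ p.-nat mX.1, mark Q mX.2 = mX.1%:Z & mark R mX.2 = 0].
Proof.
move=> ncQR; have [/existsP[x sRQ] | /existsPn nsRQ] :=
  boolP [exists x, R \subset Q :^ x]%g.
  exists (#|'N(R) : R|%g, #|'N(R) : R|%g%:R - burnside_class (coset_action R)).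
  rewrite !rmorphB !rmorph_nat /= mark_coset_self natz subrr; split=> //.
    exact: pnat_normal_index.
  rewrite mark_coset_eq0 ?subr0 // => y; apply: contra (ncQR x) => sQR.
  by rewrite eqEcard sRQ cardJg -(cardJg R y) subset_leq_card.
exists (#|'N(Q) : Q|%g, burnside_class (coset_action Q)).
rewrite mark_coset_self mark_coset_eq0 //; split=> //.
exact: pnat_normal_index.
Qed.

Lemma mark_indicator (A : {set {group G}}) :
  (forall Q R, Q \in A -> R \notin A -> forall x, (R :!=: Q :^ x)%g) ->
  exists mX : nat * burnside G,
    p.-nat mX.1 /\ forall Q, mark Q mX.2 = (if Q \in A then mX.1 else 0)%:Z.
Proof.
move=> ncA.
(* The membership hypotheses are placed under the existential so that choice yields a function of
   all pairs; (0, 0) is a dummy value. *)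
have sep QR : exists mX : nat * burnside G, QR.1 \in A -> QR.2 \notin A ->
    [/\ p.-nat mX.1, mark QR.1 mX.2 = mX.1%:Z & mark QR.2 mX.2 = 0].
  case: QR => Q R /=.
  have [QA | QnA] := boolP (Q \in A); last by exists (0%N, 0).
  have [RA | RnA] := boolP (R \in A); first by exists (0%N, 0).
  by have [mX h] := separate_nonconj (ncA Q R QA RnA); exists mX.
have {sep} [f fP] := choice sep.
pose m Q := (\prod_(R | R \notin A) (f (Q, R)).1)%N.
pose X Q := \prod_(R | R \notin A) (f (Q, R)).2.
have m_pnat Q : Q \in A -> p.-nat (m Q).
  move=> QA; rewrite /m.
  apply: (big_ind (fun k => p.-nat k)) => // [a b pa pb|R nR].
    by rewrite pnatM pa.
  by have [] := fP (Q, R) QA nR.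
have markX Q : Q \in A -> mark Q (X Q) = (m Q)%:Z.
  move=> QA; rewrite rmorph_prod /m -natz natr_prod; apply: eq_bigr => R nR.
  by rewrite natz; have [] := fP (Q, R) QA nR.
have markX0 Q R : Q \in A -> R \notin A -> mark R (X Q) = 0.
  move=> QA nR; rewrite rmorph_prod (bigD1 R) //=.
  by have [_ _ ->] := fP (Q, R) QA nR; rewrite mul0r.
(* At Q in A the factor of index Q vanishes, leaving the constant. Outside A every [X Q] vanishes,
   so the product equals the constant and cancels it. *)
exists ((\prod_(Q in A) m Q)%N,
        (\prod_(Q in A) m Q)%N%:R - \prod_(Q in A) ((m Q)%:R - X Q)).
split=> /=.
  by apply: (big_ind (fun k => p.-nat k)) => // a b pa pb; rewrite pnatM pa.
move=> Q; rewrite rmorphB rmorph_nat natz; apply/eqP.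
rewrite subr_eq; apply/eqP.
rewrite (rmorph_prod (mark Q)); case: ifP => [QA | /negbT nQ].
  rewrite [X in _ + X](bigD1 Q) //= rmorphB rmorph_nat /= markX // natz subrr.
  by rewrite mul0r addr0.
rewrite add0r -natz natr_prod; apply: eq_bigr => R RA.
by rewrite rmorphB rmorph_nat /= markX0 // subr0.
Qed.

End Burnside.

Lemma mark_res (G H : finGroupType) (f : {morphism [set: H] >-> G})
    (Q : {group H}) (X : burnside G) : mark Q (res f X) = mark (f @* Q)%G X.
Proof.
have cls n (to : {action G &-> 'I_n}) :
    mark Q (res f (burnside_class to)) = mark (f @* Q)%G (burnside_class to).
  rewrite res_class !mark_class; congr (Posz #|pred_of_set _|).
  apply/setP=> x; apply/afixP/afixP=> [h _ /morphimP[a _ Qa ->] | h a Qa].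
    exact: h a Qa.
  by apply: h; rewrite mem_morphim ?inE.
elim/burnside_ind: X => m n to to'.
rewrite (rmorphB (res f)) (rmorphB (mark Q)).
by rewrite (rmorphB (mark (f @* Q)%G)) /= !cls.
Qed.

(** * Stability in terms of marks, and indicators in A(F) *)

Section Fusion.

Variables (gT : finGroupType) (F : fusion_system gT).
Implicit Types (P Q R : {group gT}).

Lemma fhom_restrict P Q R (f : gT -> gT) :
  fhom F P R f -> Q \subset P -> fhom F Q R f.
Proof.
move=> Ff sQP; have incl : fhom F Q P id.
  rewrite (@fhom_ext _ F Q P id (fun x => (1 * x * 1^-1)%g)) => [|x _].
    by apply: fhom_conj; rewrite invg1 conjsg1.
  by rewrite mul1g invg1 mulg1.
exact: fhom_comp incl Ff.
Qed.

Lemma fusion_isomorphic_im P Q R (f : gT -> gT) :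
  fhom F P R f -> f @: P = Q -> fusion_isomorphic F P Q.
Proof.
move=> Ff fP; have [_ f_inj _] := fhom_inj Ff.
pose g y := odflt 1%g [pick x in P | f x == y].
have fK : {in P, cancel f g}.
  move=> x Px; rewrite /g.
  case: pickP => [y /andP[Py /eqP/f_inj->] // | /(_ x)].
  by rewrite /= Px eqxx.
exists f; split; first exact: fhom_im Ff fP.
exists g; split=> [|//|y]; first exact: fhom_inv Ff fP fK.
by rewrite -fP => /imsetP[x Px ->]; rewrite fK.
Qed.

Lemma fusion_isomorphic_refl P : fusion_isomorphic F P P.
Proof. by apply: fusion_isomorphic_im (fhom_id F P) _; rewrite imset_id. Qed.

Lemma fusion_isomorphic_sym P Q :
  fusion_isomorphic F P Q -> fusion_isomorphic F Q P.
Proof. by move=> [f [Ff [g [Fg fK gK]]]]; exists g; split=> //; exists f. Qed.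

Lemma fusion_isomorphic_trans P Q R :
  fusion_isomorphic F P Q -> fusion_isomorphic F Q R -> fusion_isomorphic F P R.
Proof.
move=> [f [Ff [g [Fg fK gK]]]] [h [Fh [k [Fk hK kK]]]].
have img A B (u : gT -> gT) : fhom F A B u -> {in A, forall x, u x \in B}.
  by case/fhom_inj=> _ _ /subsetP sB x Ax; apply/sB/imset_f.
exists (h \o f); split; first exact: fhom_comp Ff Fh.
exists (g \o k); split=> [|x Px /=|x Rx /=]; first exact: fhom_comp Fk Fg.
  by rewrite hK ?fK // (img _ _ _ Ff).
by rewrite gK ?kK // (img _ _ _ Fk).
Qed.

(** Makes F-isomorphism classes unions of S-conjugacy classes, as [mark_indicator] requires. *)
Lemma fusion_isomorphic_conj P Q x :
  (Q :=: P :^ x)%g -> fusion_isomorphic F Q P.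
Proof.
move=> eQ.
apply: (fusion_isomorphic_im (f := fun y => (x * y * x^-1)%g) (R := P)).
  by apply: fhom_conj; rewrite eQ conjsgK.
apply/setP=> y; rewrite eQ; apply/imsetP/idP => [[_ /imsetP[z Pz ->] ->] | Py].
  by rewrite conjgE !mulgA mulgV mul1g mulgK.
by exists (y ^ x)%g; rewrite ?memJ_conjg // conjgE !mulgA mulgV mul1g mulgK.
Qed.

(** Taking the mark of both restrictions at the whole of P gives one direction. Conversely, by
    [mark_inj] it suffices to compare marks at each subgroup of P, which f carries to an
    F-isomorphic one. *)
Lemma stableP (X : burnside gT) :
  X \in Defs.stable F <->
  (forall P Q, fusion_isomorphic F P Q -> mark P X = mark Q X).
Proof.
split=> [/asboolP stX P Q [f [Ff [g [Fg fK gK]]]] | mX].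
  have [fM _ sfQ] := fhom_inj Ff; pose fm := Morphism fM.
  have Ffm : fhom F P [set: gT]%G fm.
    exact: fhom_comp Ff (fhom_restrict (fhom_id F [set: gT]%G) (subsetT Q)).
  have := congr1 (mark [set: subg_of P]%G) (stX P fm Ffm); rewrite !mark_res.
  have -> : (sgval_morphism P @* [set: subg_of P])%G = P.
    by apply: val_inj; rewrite /= im_sgval.
  move=> <-; congr (mark _ X); apply: val_inj.
  rewrite /= morphimEdom imset_comp.
  rewrite -(morphimEdom (sgval_morphism P)) im_sgval; apply/eqP.
  rewrite eqEsubset sfQ; apply/subsetP=> y Qy.
  have [_ _ /subsetP sgP] := fhom_inj Fg.
  by rewrite -(gK y Qy); apply/imset_f/sgP/imset_f.
apply/asboolP=> P f Ff; apply/eqP; rewrite -subr_eq0; apply/eqP/mark_inj => Q.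
rewrite (rmorphB (mark Q)) /= !mark_res.
rewrite -(mX (sgval_morphism P @* Q)%G (comp_sgval f @* Q)%G) ?subrr //.
apply: fusion_isomorphic_im (fhom_restrict Ff (sgval_sub Q)) _.
by rewrite /= !morphimEsub ?subsetT // -imset_comp.
Qed.

Lemma burnside_fusion_indicator (p : nat) P :
  (p.-group [set: gT])%g ->
  exists m (e : burnside_fusion F), [/\ p.-nat m,
    forall Q, fusion_isomorphic F Q P -> mark Q (\val e) = m%:Z
    & forall Q, ~ fusion_isomorphic F Q P -> mark Q (\val e) = 0].
Proof.
move=> pS; pose A := [set Q : {group gT} | `[< fusion_isomorphic F Q P >]].
have AP Q : reflect (fusion_isomorphic F Q P) (Q \in A).
  by rewrite inE; apply: asboolP.
have [|[m X] /= [pm mX]] := @mark_indicator gT p pS A.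
  move=> Q R /AP QP /AP nRP x; apply/eqP=> /fusion_isomorphic_conj RQ.
  exact: nRP (fusion_isomorphic_trans RQ QP).
have stX : X \in Defs.stable F.
  apply/stableP=> Q R QR; rewrite !mX; congr (if _ then _ else _)%:Z.
  apply/AP/AP; apply: fusion_isomorphic_trans => //.
  exact: fusion_isomorphic_sym.
exists m, (BurnsideFusion stX).
split=> // Q /AP; rewrite /= mX; first by move->.
by move/negPf->.
Qed.

(** * Inclusions, minimality and maximality of the ideals *)

Lemma fidealE P q (X : burnside_fusion F) :
  (X \in fideal F P q) = (q%:Z %| mark P (\val X))%Z.
Proof. by []. Qed.

Lemma fideal_nat P q n : (n%:R \in fideal F P q) = (q %| n)%N.
Proof. by rewrite fidealE !rmorph_nat natz. Qed.

Lemma fideal_idealr P q : q <> 1%N -> idealr_closed (fideal F P q).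
Proof.
move=> q1; split=> [||a u v]; rewrite ?fidealE.
- by rewrite !rmorph0 dvdz0.
- by rewrite !rmorph1 dvdz1; apply/eqP.
by move=> qu qv; rewrite !rmorphD !rmorphM /= rpredD ?dvdz_mull.
Qed.

Lemma fideal_prime P q : q = 0%N \/ prime q -> prime_ideal (fideal F P q).
Proof.
move=> q0p; split.
  by apply: fideal_idealr; case: q0p => [-> | q_pr] // q1; rewrite q1 in q_pr.
move=> u v; rewrite !fidealE !rmorphM /=.
case: q0p => [-> | q_pr]; first by rewrite !dvd0z mulf_eq0.
by rewrite !dvdzE abszM Euclid_dvdM.
Qed.

Variable p : nat.
Hypotheses (p_pr : prime p) (pS : (p.-group [set: gT])%g).

Lemma fideal_subset P P' q q' :
  q = 0%N \/ prime q -> q' = 0%N \/ prime q' ->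
  (q = p -> P = [set: gT]%G) -> (q' = p -> P' = [set: gT]%G) ->
  {subset fideal F P q <= fideal F P' q'} <->
  [\/ q = q' /\ fusion_isomorphic F P P',
      [/\ q = 0%N, q' <> 0%N, q' <> p & fusion_isomorphic F P P']
    | q = 0%N /\ q' = p].
Proof.
move=> qP q'P qp q'p.
split=> [sI | ].
  (* The constant q lies in I_{P,q}. *)
  have qq' : (q' %| q)%N by rewrite -(fideal_nat P') sI // fideal_nat.
  have [q'_p | q'_np] := eqVneq q' p.
    have [q0 | q_n0] := eqVneq q 0%N; first by constructor 3.
    constructor 1; case: qP => [q0 | q_pr]; first by rewrite q0 in q_n0.
    have eq_p : q = p.
      by apply/esym/eqP; rewrite -dvdn_prime2 // -q'_p.
    split; first by rewrite eq_p q'_p.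
    by rewrite qp // q'p //; apply: fusion_isomorphic_refl.
  have PP' : fusion_isomorphic F P P'.
    (* Otherwise the indicator of the class of P' has mark 0 at P, yet at P' its mark is a power of
       p, which q' does not divide. *)
    apply: contrapT => nPP'.
    have [m [e [pm em e0]]] := burnside_fusion_indicator P' pS.
    have /sI : e \in fideal F P q by rewrite fidealE e0 // dvdz0.
    rewrite fidealE em; last exact: fusion_isomorphic_refl.
    rewrite dvdzE /= => q'm; case: q'P => [q'0 | q'_pr].
      by move: q'm pm; rewrite q'0 dvd0n => /eqP->.
    have /andP[m0 /allP/(_ q')] := pm; rewrite mem_primes q'_pr m0 q'm.
    by move/(_ isT); rewrite !inE (negPf q'_np).
  case: qP => [q0 | q_pr].
    have [q'0 | /eqP q'_n0] := eqVneq q' 0%N.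
      by constructor 1; rewrite q0 q'0.
    by constructor 2; split=> //; apply/eqP.
  constructor 1; split=> //; case: q'P => [q'0 | q'_pr].
    by move: qq' q_pr; rewrite q'0 dvd0n => /eqP->.
  by apply/esym/eqP; rewrite -dvdn_prime2.
have markPP' (X : burnside_fusion F) : fusion_isomorphic F P P' ->
    mark P (\val X) = mark P' (\val X).
  by move=> PP'; apply: (iffLR (stableP _)) PP'; apply: (valP X).
case=> [[-> PP'] | [-> _ _ PP'] | [-> ->]] X; rewrite !fidealE.
- by rewrite (markPP' X PP').
- by rewrite (markPP' X PP') dvd0z => /eqP->; rewrite dvdz0.
(* The marks at P and P' are both congruent mod p to the mark at 1, and the one at P is 0. *)
rewrite dvd0z => /eqP X0.
have := mark_modp (\val X) (pgroupS (subsetT P) pS).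
have := mark_modp (\val X) (pgroupS (subsetT P') pS).
by rewrite X0 subr0 => h h1; have := rpredB h1 h; rewrite subKr.
Qed.

Lemma fideal_minimal P q : q = 0%N \/ prime q ->
  minimal_prime_ideal (fideal F P q) <-> q = 0%N.
Proof.
move=> qP.
split=> [[_ minI] | q0].
  (* I_{P,0} is contained in I_{P,q} but misses the constant q. *)
  apply: contrapT => q_n0; have := minI _ (fideal_prime P (or_introl erefl)).
  move=> /(_ _ q%:R); rewrite !fideal_nat dvdnn dvd0n => h.
  apply: q_n0; apply/eqP; rewrite h // => X; rewrite !fidealE dvd0z => /eqP->.
  by rewrite dvdz0.
split; first exact: fideal_prime.
move=> J [[J0 J1 JD] Jprime] sJI X; apply/idP/idP; first exact: sJI.
rewrite q0 fidealE dvd0z => /eqP X0.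
have [m [e [pm em e0]]] := burnside_fusion_indicator P pS.
(* X vanishes on the class of P and e vanishes off it. Since J is prime and e is not in I_{P,0},
   this puts X in J. *)
have Xe : X * e = 0.
  apply/val_inj/mark_inj => Q; rewrite !rmorphM /=.
  have [QP | nQP] := pselect (fusion_isomorphic F Q P).
    by rewrite (iffLR (stableP _) (valP X) _ _ QP) X0 mul0r.
  by rewrite e0 // mulr0.
have /orP[//|Je] : (X \in J) || (e \in J) by apply: Jprime; rewrite Xe.
have := sJI e Je; rewrite q0 fidealE em; last exact: fusion_isomorphic_refl.
by rewrite dvd0z eqz_nat => /eqP m0; rewrite m0 in pm.
Qed.

Lemma fideal_maximal P q : q = 0%N \/ prime q ->
  maximal_ideal (fideal F P q) <-> q <> 0%N.
Proof.
move=> qP.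
split=> [[_ maxI] q0 | q_n0].
  (* I_{P,0} lies in the proper ideal I_{P,2}, which also contains the constant 2. *)
  have := maxI _ (@fideal_idealr P 2 _) _ 2%:R.
  rewrite !fideal_nat q0 => h; suff : (2 %| 2)%N = (0 %| 2)%N by [].
  by apply: h => // X; rewrite !fidealE dvd0z => /eqP->; rewrite dvdz0.
have q_pr : prime q by case: qP.
split; first by apply: fideal_idealr => q1; rewrite q1 in q_pr.
move=> J [J0 J1 JD] sIJ X; apply/idP/idP; last exact: sIJ.
move=> JX; apply: contraNT J1; rewrite fidealE => nqX.
(* With u q + v m = 1, where m is the mark of X at P, the element 1 - v X lies in I_{P,q}, so 1 lies
   in J. *)
have /coprimezP[[u v] /= uv] : coprimez q (mark P (\val X)).
  by rewrite coprimezE /= prime_coprime.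
have : 1 - v%:~R * X \in fideal F P q.
  rewrite fidealE !rmorphB !rmorphM !rmorph1 !rmorph_int /= intz -uv.
  by rewrite addrK dvdz_mull.
by move/sIJ => J1X; have := JD v%:~R _ _ JX J1X; rewrite addrC subrK.
Qed.

End Fusion.
End Marks.

Theorem proposition3p1 (p : nat) (gT : finGroupType) (F : fusion_system gT)
    (p_pr : prime p) (pS : (p.-group [set: gT])%g) (satF : fusion_saturated F p) :
  (forall (P P' : {group gT}) (q q' : nat),
     q = 0%N \/ prime q -> q' = 0%N \/ prime q' ->
     (q = p -> P = [set: gT]%G) -> (q' = p -> P' = [set: gT]%G) ->
     ({subset fideal F P q <= fideal F P' q'} <->
      [\/ q = q' /\ fusion_isomorphic F P P',
          [/\ q = 0%N, q' <> 0%N, q' <> p & fusion_isomorphic F P P']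
        | q = 0%N /\ q' = p])) /\
  (forall (P : {group gT}) (q : nat),
     q = 0%N \/ prime q -> (q = p -> P = [set: gT]%G) ->
     (minimal_prime_ideal (fideal F P q) <-> q = 0%N) /\
     (maximal_ideal (fideal F P q) <-> q <> 0%N)).
Proof.
split=> [P P' q q' qP q'P qp q'p | P q qP _]; first exact: fideal_subset.
by split; [apply: fideal_minimal pS _ _ qP | apply: fideal_maximal].
Qed.
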